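(* Let $1\le p<\infty$. There exists a hypercyclic weighted backward shift $B_w$ on $\ell^p(\mathbb{Z})$ such that for every non-zero vector $x\in\ell^p(\mathbb{Z})$, \[\lim_{n\to\infty}\frac1n\sum_{i=1}^n\Vert B_w^ix\Vert=\infty.\]
   Context: For a bounded sequence $w=(w_n)_{n\in\mathbb{Z}}$ of non-zero scalars, the (bilateral) weighted backward shift with weight $w$ is the bounded linear operator $B_w\colon\ell^p(\mathbb{Z})\to\ell^p(\mathbb{Z})$, $B_w\big((x_n)_{n\in\mathbb{Z}}\big)=(w_{n+1}x_{n+1})_{n\in\mathbb{Z}}$; equivalently $B_we_n=w_ne_{n-1}$ for the canonical basis $(e_n)_{n\in\mathbb{Z}}$. A bounded linear operator $T$ on a Banach space $X$ is hypercyclic if there is $x\in X$ whose orbit $\{T^nx:n\ge 0\}$ is dense in $X$. $B_w^i$ denotes the $i$-fold composition. *)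

(* Defs.v *)
From HB Require Import structures.
From mathcomp Require Import all_boot all_order all_algebra.
From mathcomp Require Import complex.
From mathcomp Require Import all_classical all_reals all_analysis.
From mathcomp Require Import ring.

Set Implicit Arguments.
Unset Strict Implicit.
Unset Printing Implicit Defensive.
Import Order.TTheory GRing.Theory Num.Theory.
Import numFieldNormedType.Exports.
Local Open Scope classical_set_scope.
Local Open Scope ring_scope.

(* Fields with an absolute value valued in [R]; used to treat real and complex
   scalars uniformly (the norm of [R[i]] as a numDomainType is [R[i]]-valued). *)
Record absField (R : realType) := AbsField {
  absField_sort :> fieldType ;
  absv : absField_sort -> R ;
  absv_ge0 : forall a, 0 <= absv a ;
  absv_eq0 : forall a, absv a = 0 -> a = 0 ;
  absv_nat : forall n : nat, absv n%:R = n%:R ;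
  absvD : forall a b, absv (a + b) <= absv a + absv b ;
  absvM : forall a b, absv (a * b) = absv a * absv b }.

Section scalar_fields.
Variable R : realType.

Definition real_scalars : absField R :=
  @AbsField R R Num.norm (@normr_ge0 _ _) (fun a => @normr0_eq0 _ _ a)
    (fun n => normr_nat R n) (@ler_normD _ _) (@normrM R).

Lemma normc_ge0 (z : R[i]) : 0 <= Normc.normc z.
Proof. by case: z => a b; rewrite /Normc.normc sqrtr_ge0. Qed.

Lemma normc_nat n : Normc.normc (n%:R : R[i]) = n%:R.
Proof. by rewrite (normcMn (1 : Rcomplex R)) Normc.normc1. Qed.

Definition complex_scalars : absField R :=
  @AbsField R R[i] (@Normc.normc R) normc_ge0 (@Normc.eq0_normc R)
    normc_nat (@le_normcD R) (@Normc.normcM R).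

End scalar_fields.

Variant scalar_kind := RealScalars | ComplexScalars.

Definition scalars (R : realType) (k : scalar_kind) : absField R :=
  match k with
  | RealScalars => real_scalars R
  | ComplexScalars => complex_scalars R
  end.

Section absField_theory.
Context {R : realType} (K : absField R).

Lemma absv0 : absv (0 : K) = 0.
Proof. exact: (absv_nat K 0). Qed.

Lemma absv1 : absv (1 : K) = 1.
Proof. exact: (absv_nat K 1). Qed.

Lemma absvN (a : K) : absv (- a) = absv a.
Proof.
rewrite -mulN1r absvM; suff -> : absv (-1 : K) = 1 by rewrite mul1r.
have /eqP : absv (-1 : K) ^+ 2 = 1 by rewrite expr2 -absvM mulrNN mulr1 absv1.
by rewrite sqrf_eq1 => /orP[/eqP//|/eqP e]; have := absv_ge0 (-1 : K);
  rewrite e ler0N1.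
Qed.

End absField_theory.

Lemma esumZl_fin (R : realType) (T : choiceType) (S : set T) (c : R)
    (a : T -> \bar R) : 0 <= c -> (forall i, 0 <= a i)%E ->
  (\esum_(i in S) (c%:E * a i) = c%:E * \esum_(i in S) a i)%E.
Proof.
have le (d : R) (b : T -> \bar R) : 0 <= d -> (forall i, 0 <= b i)%E ->
    (\esum_(i in S) (d%:E * b i) <= d%:E * \esum_(i in S) b i)%E.
  move=> d0 b0; rewrite ge_ereal_sup => //= _ [X [finX XS]] <-.
  rewrite -ge0_mule_fsumr//; apply: lee_wpmul2l; first by rewrite lee_fin.
  by apply: ereal_sup_ubound; exists X.
rewrite le_eqVlt => /orP[/eqP<- a0|c0 a0].
  by rewrite mul0e esum1// => i _; rewrite mul0e.
apply/eqP; rewrite eq_le le ?(ltW c0)//= -lee_pdivlMl//.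
have ca i : (0 <= c%:E * a i)%E by rewrite mule_ge0 ?a0// lee_fin ltW.
have := le c^-1 _ _ ca; rewrite invr_ge0 (ltW c0) => /(_ isT).
by under eq_esum do rewrite muleA -EFinM mulVf ?gt_eqF// mul1e.
Qed.

Lemma le_powR2 (R : realType) (p a b : R) : 0 < p -> 0 <= a -> 0 <= b ->
  (a `^ p <= b `^ p) = (a <= b).
Proof.
move=> p0 a0 b0; have [ab|ba] := leP a b.
  by rewrite ge0_ler_powR ?nnegrE ?(ltW p0).
by apply/negbTE; rewrite -ltNge gt0_ltr_powR ?nnegrE.
Qed.

Lemma powRD_le_weighted (R : realType) (p A B a b : R) : 1 <= p ->
  0 < A -> 0 < B -> 0 <= a -> 0 <= b ->
  (a + b) `^ p <= (A + B) `^ p *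
    (A / (A + B) * (a `^ p / A `^ p) + B / (A + B) * (b `^ p / B `^ p)).
Proof.
move=> p1 A0 B0 a0 b0; have AB0 : 0 < A + B by rewrite addr_gt0.
have s0 : 0 <= A / (A + B) by rewrite divr_ge0 ?ltW.
have s1 : A / (A + B) <= 1 by rewrite ler_pdivrMr// mul1r lerDl ltW.
have := convex_powR p1 (Itv01 s0 s1) (x := a / A) (y := b / B).
rewrite !inE/= !in_itv/= !andbT !divr_ge0 ?(ltW A0) ?(ltW B0)//.
move=> /(_ isT isT); rewrite !convRE/=.
have oE : unstable.onem (A / (A + B)) = B / (A + B).
  by rewrite /unstable.onem; field; rewrite gt_eqF.
have pV (u v : R) : 0 <= u -> 0 < v -> (u / v) `^ p = u `^ p / v `^ p.
  by move=> u0 v0; rewrite powRM ?invr_ge0 ?(ltW v0)// -powR_inv1 ?(ltW v0)// -powRrM mulN1r powRN.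
rewrite oE !pV// => h.
have -> : a + b = (A + B) * (A / (A + B) * (a / A) + B / (A + B) * (b / B)).
  by field; rewrite !gt_eqF.
have X0 : 0 <= A / (A + B) * (a / A) + B / (A + B) * (b / B).
  by rewrite addr_ge0// !(mulr_ge0, invr_ge0, ltW A0, ltW B0, ltW AB0).
rewrite powRM ?X0 ?(ltW AB0)// ler_wpM2l ?powR_ge0//.
by move: h; rewrite -oE; exact.
Qed.

Section lp_sum.
Context {R : realType} (K : absField R).
Implicit Types (p c : R) (x y w : int -> K^o).

Definition lp_sum p x : \bar R := \esum_(n in setT) (absv (x n) `^ p)%:E.

Definition lp_norm p x : R := fine (lp_sum p x) `^ p^-1.

Definition lp_pred p : {pred (int -> K^o)} := [pred x | lp_sum p x < +oo]%E.

Lemma lp_sum_ge0 p x : (0 <= lp_sum p x)%E.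
Proof. by apply: esum_ge0 => n _; rewrite lee_fin powR_ge0. Qed.

Lemma lp_sum_fin p x : x \in lp_pred p -> lp_sum p x \is a fin_num.
Proof. by move=> xp; rewrite ge0_fin_numE// lp_sum_ge0. Qed.

Lemma lp_norm_ge0 p x : 0 <= lp_norm p x.
Proof. exact: powR_ge0. Qed.

Lemma lp_norm_powR p x : 0 < p -> x \in lp_pred p ->
  lp_sum p x = (lp_norm p x `^ p)%:E.
Proof.
move=> p0 xp; rewrite /lp_norm -powRrM mulVf ?gt_eqF// powRr1.
  by rewrite fineK// lp_sum_fin.
by rewrite fine_ge0// lp_sum_ge0.
Qed.

Lemma lp_sum_le p x c : 0 < p -> 0 <= c -> (lp_sum p x <= (c `^ p)%:E)%E ->
  x \in lp_pred p /\ lp_norm p x <= c.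
Proof.
move=> p0 c0 le; have xp : x \in lp_pred p.
  by rewrite inE (le_lt_trans le)// ltry.
split=> //; move: le; rewrite lp_norm_powR// lee_fin.
by rewrite le_powR2 ?lp_norm_ge0.
Qed.

Lemma absv_le_lp_norm p x n : 0 < p -> x \in lp_pred p ->
  absv (x n) <= lp_norm p x.
Proof.
move=> p0 xp.
have : ((absv (x n) `^ p)%:E <= lp_sum p x)%E.
  by apply: esum_ge; exists [set n] => //; rewrite fsbig_set1.
by rewrite lp_norm_powR// lee_fin le_powR2 ?lp_norm_ge0 ?absv_ge0.
Qed.

Lemma lp_norm_eq0 p x : 0 < p -> x \in lp_pred p -> lp_norm p x = 0 -> x = 0.
Proof.
move=> p0 xp x0; apply/funext => n; apply: absv_eq0; apply/eqP.
by rewrite eq_le absv_ge0 -x0 absv_le_lp_norm.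
Qed.

Lemma lp_sumZ p (a : K) x : 
  lp_sum p (fun n => a * x n) = ((absv a `^ p)%:E * lp_sum p x)%E.
Proof.
rewrite /lp_sum -esumZl_fin ?powR_ge0//; last first.
  by move=> n; rewrite lee_fin powR_ge0.
by apply: eq_esum => n _ /=; rewrite absvM powRM ?absv_ge0.
Qed.

Lemma lp_normZ p (a : K) x : 0 < p -> x \in lp_pred p ->
  lp_norm p (fun n => a * x n) = absv a * lp_norm p x.
Proof.
move=> p0 xp; have pp : p * p^-1 = 1 by rewrite divff ?gt_eqF.
rewrite /lp_norm lp_sumZ fineM ?lp_sum_fin//= powRM ?powR_ge0 ?fine_ge0 ?lp_sum_ge0//.
by rewrite -powRrM pp powRr1 ?absv_ge0.
Qed.

Lemma lp_minkowski p x y : 1 <= p -> x \in lp_pred p -> y \in lp_pred p ->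
  (fun n => x n + y n) \in lp_pred p /\
  lp_norm p (fun n => x n + y n) <= lp_norm p x + lp_norm p y.
Proof.
move=> p1 xp yp; have p0 : 0 < p by rewrite (lt_le_trans ltr01).
have [/(lp_norm_eq0 p0 xp) ->|A0] := eqVneq (lp_norm p x) 0.
  rewrite (_ : (fun _ => _) = y); last by apply/funext => n; rewrite add0r.
  by rewrite lerDr lp_norm_ge0.
have [/(lp_norm_eq0 p0 yp) ->|B0] := eqVneq (lp_norm p y) 0.
  rewrite (_ : (fun _ => _) = x); last by apply/funext => n; rewrite addr0.
  by rewrite lerDl lp_norm_ge0.
move: (lp_norm_powR p0 xp) (lp_norm_powR p0 yp).
have := lp_norm_ge0 p x; have := lp_norm_ge0 p y.
move: (lp_norm p x) (lp_norm p y) A0 B0 => A B.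
rewrite !neq_lt => /orP[A0|A0] /orP[B0|B0] B0' A0' sx sy;
  rewrite ?(lt_geF A0)// ?(lt_geF B0)// in A0' B0' *.
have AB0 : 0 < A + B by rewrite addr_gt0.
apply: lp_sum_le => //; first by rewrite ltW.
pose s := A / (A + B); pose t := B / (A + B).
pose cx := (A + B) `^ p * s / A `^ p; pose cy := (A + B) `^ p * t / B `^ p.
have cx0 : 0 <= cx by rewrite !mulr_ge0 ?invr_ge0 ?powR_ge0 ?ltW.
have cy0 : 0 <= cy by rewrite !mulr_ge0 ?invr_ge0 ?powR_ge0 ?ltW.
apply: (@le_trans _ _ (cx%:E * lp_sum p x + cy%:E * lp_sum p y)%E).
  rewrite -!esumZl_fin//; try by move=> n; rewrite lee_fin powR_ge0.
  rewrite -esumD; try by move=> n _; rewrite -EFinM lee_fin mulr_ge0 ?powR_ge0.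
  apply: le_esum => n _; rewrite -!EFinM -EFinD lee_fin.
  apply: (@le_trans _ _ ((absv (x n) + absv (y n)) `^ p)).
    by rewrite le_powR2 ?addr_ge0 ?absv_ge0 ?absvD.
  apply: (le_trans (powRD_le_weighted p1 A0 B0 (absv_ge0 _) (absv_ge0 _))).
  by rewrite le_eqVlt; apply/orP; left; apply/eqP; rewrite /cx /cy /s /t; ring.
rewrite sx sy -!EFinM -EFinD lee_fin /cx /cy !divfK ?gt_eqF ?powR_gt0//.
by rewrite -mulrDr /s /t -mulrDl divff ?gt_eqF// mulr1.
Qed.

End lp_sum.

Section lp_space.
Context {R : realType} (K : absField R) (p : R) (p1 : 1 <= p).

Let p0 : 0 < p. Proof. exact: lt_le_trans p1. Qed.

(* [p1] is a dummy argument letting the closure instance below be inferred. *)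
Definition lp_mem (_ : 1 <= p) : {pred (int -> K^o)} := lp_pred p.

(* The space l^p(Z): a [K]-module carrying the topology of the [R]-valued norm
   [lp_norm p]. The type [K^o] is [K] seen as a module over itself. *)
Record lp := Lp { lp_seq :> int -> K^o ; lp_seqP : lp_seq \in lp_mem p1 }.

HB.instance Definition _ := [isSub for lp_seq].
HB.instance Definition _ := [Choice of lp by <:].

Lemma lp_submod_closed : submod_closed (lp_mem p1).
Proof.
split.
  rewrite inE /lp_sum esum1 ?ltry// => n _ /=.
  by rewrite absv0 powR0// gt_eqF.
move=> a x y xp yp.
have axp : (fun n => a * x n) \in lp_pred p.
  rewrite inE lp_sumZ lte_mul_pinfty ?lee_fin ?powR_ge0//.
by have [] := lp_minkowski p1 axp yp.
Qed.

HB.instance Definition _ :=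
  GRing.isSubmodClosed.Build _ _ (lp_mem p1) lp_submod_closed.
HB.instance Definition _ := [SubChoice_isSubLmodule of lp by <:].

Implicit Types x y : lp.

Lemma lp_normD x y : lp_norm p (x + y) <= lp_norm p x + lp_norm p y.
Proof. by have [] := lp_minkowski p1 (lp_seqP x) (lp_seqP y). Qed.

Lemma lp_norm0_eq0 x : lp_norm p x = 0 -> x = 0.
Proof. by move=> /(lp_norm_eq0 p0 (lp_seqP x)) x0; exact: val_inj. Qed.

Lemma lp_normZ_seq (a : K) x : lp_norm p (a *: x) = absv a * lp_norm p x.
Proof. exact: lp_normZ (lp_seqP x). Qed.

Lemma lp_normMn x n : lp_norm p (x *+ n) = lp_norm p x *+ n.
Proof. by rewrite -scaler_nat lp_normZ_seq absv_nat mulr_natl. Qed.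

Lemma lp_normN x : lp_norm p (- x) = lp_norm p x.
Proof. by rewrite -scaleN1r lp_normZ_seq absvN absv1 mul1r. Qed.

HB.instance Definition _ := Num.Zmodule_isNormed.Build R lp
  lp_normD lp_norm0_eq0 lp_normMn lp_normN.
HB.instance Definition _ := PseudoMetric.copy lp (pseudoMetric_normed lp).
HB.instance Definition _ := isPointed.Build lp 0.
HB.instance Definition _ := NormedZmod_PseudoMetric_eq.Build R lp erefl.

Lemma lp_normE x : `|x| = lp_norm p x. Proof. by []. Qed.

End lp_space.
Arguments lp {R} K {p} p1.

Record weight (R : realType) (K : absField R) := Weight {
  weight_seq :> int -> K ;
  weight_bounded : exists M : R, forall n, absv (weight_seq n) <= M ;
  weight_neq0 : forall n, weight_seq n != 0 }.

Section backward_shift.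
Context {R : realType} {K : absField R} {p : R} (p1 : 1 <= p) (w : weight K).

Let p0 : 0 < p. Proof. exact: lt_le_trans p1. Qed.

Definition bshift_seq (x : int -> K^o) : int -> K^o :=
  fun n => w (n + 1) * x (n + 1).

Lemma bshift_seq_le (M : R) (x : int -> K^o) :
  (forall n, absv (w n) <= M) -> x \in lp_pred p ->
  bshift_seq x \in lp_pred p /\ lp_norm p (bshift_seq x) <= M * lp_norm p x.
Proof.
move=> wM xp; have M0 : 0 <= M by rewrite (le_trans (absv_ge0 (w 0))).
apply: lp_sum_le => //; first by rewrite mulr_ge0 ?lp_norm_ge0.
rewrite powRM ?lp_norm_ge0// EFinM -lp_norm_powR//.
rewrite /lp_sum [in leRHS](reindex_esum setT setT (fun n : int => n + 1)); last first.
  by split => // [m n _ _ /addIr//|n _]; exists (n - 1) => //; rewrite subrK.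
rewrite -esumZl_fin ?powR_ge0//; last by move=> n; rewrite lee_fin powR_ge0.
apply: le_esum => n _; rewrite -EFinM lee_fin absvM powRM ?absv_ge0//.
by rewrite ler_wpM2r ?powR_ge0// le_powR2 ?absv_ge0.
Qed.

Lemma bshift_subproof (x : lp K p1) : bshift_seq x \in lp_mem p1.
Proof.
have [M wM] := weight_bounded w.
by have [] := bshift_seq_le wM (lp_seqP x).
Qed.

Definition bshift (x : lp K p1) : lp K p1 := Lp (bshift_subproof x).

Lemma bshift_is_linear : linear bshift.
Proof.
move=> a x y; apply: val_inj; apply/funext => n /=.
by rewrite /bshift_seq mulrDr mulrCA.
Qed.

HB.instance Definition _ :=
  GRing.isLinear.Build K (lp K p1) (lp K p1) _ bshift bshift_is_linear.

Lemma bshift_bounded : exists M : R, forall x, `|bshift x| <= M * `|x|.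
Proof.
have [M wM] := weight_bounded w; exists M => x.
by have [] := bshift_seq_le wM (lp_seqP x).
Qed.

Lemma bshift_continuous : continuous bshift.
Proof.
have [M bM] := bshift_bounded.
move=> x; apply/(@cvgrPdist_lt _ _ _ _ (nbhs_filter x)) => e e0.
have M1 : 0 < `|M| + 1 by rewrite ltr_wpDl.
have d0 : 0 < e / (`|M| + 1) by rewrite divr_gt0.
have le_e (r : R) : 0 <= r -> r < e / (`|M| + 1) -> M * r < e.
  rewrite ltr_pdivlMr// mulrC => r0; apply: le_lt_trans.
  by rewrite ler_wpM2r// (le_trans (ler_norm M))// lerDl.
apply: (filterS _ (nbhsx_ballx x _ d0)) => y; rewrite -ball_normE => xy.
by rewrite -linearB; apply: le_lt_trans (bM _) (le_e _ (normr_ge0 _) xy).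
Qed.

End backward_shift.
Arguments bshift {R K p} p1 w x.

Definition hypercyclic (X : topologicalType) (T : X -> X) : Prop :=
  exists x : X, dense (range (fun n : nat => iter n T x)).

(* Main.v *)
Require Import Defs.
From HB Require Import structures.
From mathcomp Require Import all_boot all_order all_algebra.
From mathcomp Require Import all_classical all_reals all_analysis.
From mathcomp Require Import complex zify ring lra.
Import Order.TTheory GRing.Theory Num.Theory.
Import numFieldNormedType.Exports.
Local Open Scope classical_set_scope.
Local Open Scope ring_scope.

(* The weights are [w_n = phi (n-1) / phi n] with [phi n = 4 ^ expo n], so that
   [B^i e_n = phi (n-i) / phi n *: e_(n-i)]. To the right, [expo n = - n]; to the
   left, [expo (- i) = i - 4 * 8^K] for [8^K <= i < 8^(K+1)]: it climbs with slope
   1 and falls back at each power of 8.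

   At [i = 8^(K+1) - 1] the potential is about [4 ^ (i/2)], so this single term
   of the orbit of any basis vector makes all the means over lengths up to about
   [8^(K+2)] huge; a nonzero [x] dominates a multiple of some basis vector.

   For [8^a <= i <= 2 * 8^a], on the other hand, [phi (- i) <= 4 ^ (- i)]. Writing
   a vector as [phi * u], [B] merely translates [u]. Let [u] be the
   disjoint union of copies of [y_k / phi] centred at [m_k = 2 * 8^(a_k)], where
   [(y_k)] lists a countable dense set of finitely supported vectors, each of them
   infinitely often. If [a_k] grows fast, then after [m_l] steps block [l] has
   become [y_l], earlier blocks lie in the region where [phi] is tiny, later ones
   are far to the right, and [B^(m_l) (phi * u)] is within [C * 2^-l] of [y_l]. *)

(** * The exponent of the potential: slope, dips and peaks *)

Definition expo (n : int) : int :=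
  match n with
  | Posz m => - m%:Z
  | Negz m => m.+1%:Z - (4 * 8 ^ trunc_log 8 m.+1)%N%:Z
  end.

(** Going left, [expo] climbs by one except where [trunc_log] jumps, and a jump only lowers it. This
    keeps the weights bounded. *)
Lemma expo_sub_le1 (n : int) : expo (n - 1) - expo n <= 1.
Proof.
case: n => [[|m]|m].
- by [].
- by rewrite (_ : m.+1%:Z - 1 = m%:Z) /=; lia.
- rewrite (_ : Negz m - 1 = Negz m.+1) /=; last lia.
  have : (8 ^ trunc_log 8 m.+1 <= 8 ^ trunc_log 8 m.+2)%N.
    by rewrite leq_exp2l// leq_trunc_log.
  lia.
Qed.

Lemma expo_negE (K i : nat) : (8 ^ K <= i < 8 ^ K.+1)%N ->
  expo (- i%:Z) = i%:Z - (4 * 8 ^ K)%N%:Z.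
Proof.
move=> iK; have : (0 < i)%N by case/andP: iK => + _; apply: leq_trans; rewrite expn_gt0.
case: i iK => // m mK _.
by rewrite (_ : - m.+1%:Z = Negz m)//= (trunc_log_eq _ mK).
Qed.

(** Here [i - 4 * 8^a <= - i] amounts to [i <= 2 * 8^a]; hence the factor 4 in [expo]. *)
Lemma expo_le_neg (a i : nat) : (8 ^ a <= i <= 2 * 8 ^ a)%N ->
  expo (- i%:Z) <= - i%:Z.
Proof.
move=> /andP[ai ia]; rewrite (@expo_negE a); first by lia.
by rewrite ai expnS; have := expn_gt0 8 a; lia.
Qed.

Lemma expo_large (n0 : int) (N : nat) : (20 * `|n0| + 20 <= N)%N ->
  exists i t : nat, [/\ (1 <= i <= N)%N, expo (n0 - i%:Z) = t%:Z &
     (N <= 64 * t + `|n0|)%N].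
Proof.
move=> Nlarge; pose L := `|N%:Z - n0|%N.
have LE : L%:Z = N%:Z - n0 by rewrite /L; lia.
have := @trunc_log_bounds 8 L.+1 isT isT => /=.
have : (0 < trunc_log 8 L.+1)%N by rewrite trunc_log_gt0/=; lia.
case: (trunc_log 8 L.+1) => // K _; rewrite !(expnS _ K) !(expnS _ K.+1) !(expnS _ K).
move=> /andP[lo hi]; have := expn_gt0 8 K; rewrite /= => q0.
(* [n0 - i = -(8^(K+1) - 1)] is the top of the last climb reached within [N] steps; [expo] equals
   [4 * 8^K - 1] there, while [N - n0 < 8^(K+2)]. *)
pose i := `|(n0 + (8 * 8 ^ K)%N%:Z - 1)%R|%N.
have iE : i%:Z = n0 + (8 * 8 ^ K)%N%:Z - 1 by rewrite /i; lia.
exists i, (4 * 8 ^ K - 1)%N; split; [lia| |lia].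
rewrite (_ : n0 - i%:Z = - ((8 * 8 ^ K - 1)%N%:Z)); last lia.
by rewrite (@expo_negE K) ?expnS; lia.
Qed.

(** * Domination by a two-sided geometric sequence *)

Lemma esum_half_pow (R : realType) :
  (\esum_(n in [set: int]) ((2^-1 : R) ^+ `|n|%N)%:E <= 4%:E)%E.
Proof.
have h0 (n : nat) : (0 <= ((2^-1 : R) ^+ n)%:E)%E by rewrite lee_fin exprn_ge0.
rewrite (esumID (range Posz)); last by move=> n _.
rewrite !setTI.
rewrite (_ : ~` range Posz = range Negz); last first.
  apply/seteqP; split=> [[m|m]|_ [m _ <-]] //=.
  - by move=> h; exfalso; apply: h; exists m.
  - by exists m.
  - by case.
rewrite (@reindex_esum _ _ _ setT (range Posz) Posz); last first.
  by split=> // m n _ _ [].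
rewrite (@reindex_esum _ _ _ setT (range Negz) Negz); last first.
  by split=> // m n _ _ [].
rewrite -!nneseries_esumT//.
(* The nonnegative indices sum to 2 and the negative ones to 1; the last 1 is slack. *)
rewrite (_ : (4 : R) = 2 / 2 ^+ 0 + 1 / 2 ^+ 0 + 1); last by rewrite expr0; lra.
rewrite EFinD EFinD.
apply: (@le_trans _ _ ((2 / 2 ^+ 0)%:E + (1 / 2 ^+ 0)%:E)%E); last first.
  by rewrite leeDl// lee_fin.
apply: leeD; rewrite le_eqVlt; apply/orP; left; apply/eqP/cvg_lim => //.
- have := @cvg_geometric_eseries_half R 2 0; apply: cvg_trans.
  apply: near_eq_cvg; near=> n; apply: eq_bigr => k _.
  by rewrite addn1 natrX exprS invfM mulrA divff ?mul1r ?exprVn.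
- have := @cvg_geometric_eseries_half R 1 0; apply: cvg_trans.
  apply: near_eq_cvg; near=> n; apply: eq_bigr => k _.
  by rewrite addn1 natrX mul1r exprVn.
Unshelve. all: by end_near. Qed.

(** Turns coordinatewise bounds into norm bounds with one constant: for [p >= 1], the [p]-th power
    of [2^-|n|] is at most [2^-|n|], which is summable. *)
Lemma lp_norm_dominated (R : realType) (K : absField R) (p : R) : 1 <= p ->
  exists2 C : R, 0 <= C & forall (z : int -> K^o) (c : R), 0 <= c ->
    (forall n, absv (z n) <= c * 2^-1 ^+ `|n|%N) ->
    z \in lp_pred p /\ lp_norm p z <= c * C.
Proof.
move=> p1; have p0 : 0 < p by apply: lt_le_trans p1.
exists (4 `^ p^-1); first exact: powR_ge0.
move=> z c c0 zc; apply: lp_sum_le => //; first by rewrite mulr_ge0 ?powR_ge0.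
rewrite powRM ?powR_ge0// -powRrM mulVf ?gt_eqF// powRr1// EFinM.
apply: le_trans (lee_wpmul2l _ (@esum_half_pow R)); last first.
  by rewrite lee_fin powR_ge0.
rewrite -esumZl_fin ?powR_ge0//.
apply: le_esum => n _; rewrite -EFinM lee_fin.
apply: (@le_trans _ _ ((c * 2^-1 ^+ `|n|%N) `^ p)).
  by rewrite le_powR2 ?absv_ge0// mulr_ge0// exprn_ge0.
rewrite powRM ?exprn_ge0// ler_wpM2l ?powR_ge0// ge1r_powR//.
by rewrite exprn_gt0//= exprn_ile1// invf_le1// ler1n.
Qed.

(** * The potential, the weights and the iterates of the shift *)

Section potential.
Context {R : realType} (K : absField R).

Lemma absvV (a : K) : absv a^-1 = (absv a)^-1.
Proof.
have [->|a0] := eqVneq a 0; first by rewrite !(invr0, absv0).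
have va0 : absv a != 0 by apply: contra_neq a0 => /absv_eq0.
by apply: (mulIf va0); rewrite -absvM !mulVf// absv1.
Qed.

Lemma absvXn (a : K) (n : nat) : absv (a ^+ n) = absv a ^+ n.
Proof. by elim: n => [|n IH]; rewrite ?absv1// !exprS absvM IH. Qed.

Lemma absv_exprz (a : K) (z : int) : absv (a ^ z) = absv a ^ z.
Proof. by case: z => n; rewrite ?NegzE -?invr_expz ?absvV ?absvXn. Qed.

Lemma nat4_neq0 : (4%:R : K) != 0.
Proof. by apply/eqP => /(congr1 (@absv R K)); rewrite absv_nat absv0; lra. Qed.

Definition phi (n : int) : K := 4%:R ^ expo n.

Lemma phi_neq0 n : phi n != 0.
Proof. by rewrite expfz_neq0// nat4_neq0. Qed.

Lemma absv_phi n : absv (phi n) = 4 ^ expo n.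
Proof. by rewrite absv_exprz absv_nat. Qed.

Definition shift_coef (n : int) : K := phi (n - 1) / phi n.

Lemma absv_shift_coef_le n : absv (shift_coef n) <= 4.
Proof.
rewrite absvM absvV !absv_phi invr_expz -expfzDr ?pnatr_eq0//.
by rewrite -[leRHS]expr1z; apply: ler_weXz2l (expo_sub_le1 n); rewrite ler1n.
Qed.

Lemma shift_coef_neq0 n : shift_coef n != 0.
Proof. by rewrite mulf_neq0 ?invr_eq0 ?phi_neq0. Qed.

Definition shift_weight : weight K :=
  Weight (ex_intro _ (4 : R) absv_shift_coef_le) shift_coef_neq0.

(** [4^-|n|] is split in two: one factor will absorb the size of a coordinate, the other remains as
    summable decay. *)
Lemma absv_phi_le n : expo n <= - `|n|%N%:Z ->
  absv (phi n) <= 2^-1 ^+ `|n|%N * 2^-1 ^+ `|n|%N.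
Proof.
move=> h; rewrite absv_phi -exprMn -invfM -natrM exprVn.
rewrite (_ : _ ^- _ = (4 : R) ^ (- `|n|%N%:Z)); last by rewrite -exprnN.
by apply: ler_weXz2l; rewrite ?ler1n.
Qed.

Context {p : R} (p1 : 1 <= p).

(** The product of the weights telescopes. *)
Lemma iter_shiftE (x : lp K p1) (i : nat) (n : int) :
  iter i (bshift p1 shift_weight) x n = phi n / phi (n + i%:Z) * x (n + i%:Z).
Proof.
elim: i n => [|i IH] n.
  by rewrite /= addr0 divff ?phi_neq0// mul1r.
rewrite iterS /= /bshift_seq IH /= /shift_coef addrK mulrA.
rewrite (_ : n + 1 + i%:Z = n + i.+1%:Z); last lia.
by rewrite [in LHS]mulrA divfK ?phi_neq0.
Qed.

End potential.

(** * Divergence of the Cesaro means *)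

Lemma shift_cesaro (R : realType) (K : absField R) (p : R) (p1 : 1 <= p)
    (x : lp K p1) : x != 0 ->
  (n%:R^-1 * \sum_(1 <= i < n.+1) `|iter i (bshift p1 (shift_weight K)) x|)
    @[n --> \oo] --> (+oo : set_system R).
Proof.
move=> x0; have p0 : 0 < p := lt_le_trans ltr01 p1.
have [n0 xn0] : exists n0, x n0 != 0.
  apply: contrapT => h; case/eqP: x0; apply: val_inj; apply/funext => n /=.
  by apply/eqP; apply: contraT => xn0; case: h; exists n.
(* The coordinate [n0 - i] of the [i]-th iterate has absolute value [c * 4 ^ expo (n0 - i)]. *)
pose c := absv (x n0) / absv (phi K n0).
have absv_gt0 (a : K) : a != 0 -> 0 < absv a.
  move=> a0; rewrite lt0r absv_ge0 andbT.
  by apply: contra_neq a0; exact: absv_eq0.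
have c0 : 0 < c by rewrite divr_gt0 ?absv_gt0 ?phi_neq0.
have lower i : c * 4 ^ expo (n0 - i%:Z) <=
    `|iter i (bshift p1 (shift_weight K)) x|.
  apply: le_trans (absv_le_lp_norm (n0 - i%:Z) p0 (lp_seqP _)).
  rewrite iter_shiftE subrK !absvM absvV absv_phi /c.
  by rewrite le_eqVlt; apply/orP; left; apply/eqP; ring.
apply/cvgryPge => A; pose M := Num.bound (65 * `|A| / c).
have AM : A <= c * (M%:R / 65).
  have := unstable.ltr_bound (65 * `|A| / c); rewrite -/M.
  rewrite ltr_pdivrMr// => h; have := ler_norm A; lra.
(* With [N <= 64 * t + |n0|], this threshold forces [|n0| <= t], hence [N <= 65 * t], and also
   [M <= t]. *)
exists (65 * (`|n0| + 20 + M))%N => // N /= N0.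
have /(expo_large n0 N)[i [t [/andP[i1 iN] et Nt]]] : (20 * `|n0| + 20 <= N)%N by lia.
have t0 : (0 < t)%N by lia.
have Mt : (M <= t)%N by lia.
have N65 : (N <= 65 * t)%N by lia.
have Npos : 0 < N%:R :> R by rewrite ltr0n; lia.
apply: (le_trans AM); rewrite ler_pdivlMl//.
rewrite (bigD1_seq i) ?iota_uniq//=; last by rewrite mem_index_iota; lia.
rewrite -[leLHS]addr0 lerD ?sumr_ge0//.
apply: le_trans (lower i); rewrite et -exprnP mulrCA ler_wpM2l ?(ltW c0)//.
rewrite -natrX.
(* [N * M <= 65 * t^2], and [t < 2^t] gives [t^2 <= 4^t]. *)
have : (N * M <= 4 ^ t * 65)%N.
  have tt : (t * t <= 4 ^ t)%N.
    by rewrite (_ : 4 = 2 * 2)%N// expnMn leq_mul// ltnW// ltn_expl.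
  by apply: (@leq_trans (65 * t * t)); [exact: leq_mul|lia].
by rewrite mulrA ler_pdivrMr// -!natrM ler_nat.
Qed.

(** * Placing the blocks and building the universal vector *)

(** Blocks of radius [c k] around [2 * 8 ^ a k] become disjoint, and those before block [l] lie in
    [[0, a l]]. As [a l < 8 ^ a l], moving them left by [2 * 8 ^ a l] brings them into the range of
    [expo_le_neg]. *)
Lemma exists_fast_positions (c : nat -> nat) : exists a : nat -> nat,
  (forall l, 2 * c l + l <= a l)%N /\
  (forall k l, k < l -> 2 * 8 ^ a k + c k + l <= a l)%N.
Proof.
pose a := fix a l := match l with
  | 0 => 2 * c 0
  | l'.+1 => 2 * 8 ^ a l' + 2 * c l' + 2 * c l'.+1 + l'.+1
  end%N.
exists a; split=> [[|l]|k]; rewrite /=; [lia|lia|].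
elim=> // l IH; rewrite ltnS leq_eqVlt /= => /orP[/eqP ->|/IH]; first lia.
by have := ltn_expl (a l) (isT : 1 < 8)%N; lia.
Qed.

Section universal_vector.
Context {R : realType} (K : absField R).
Variables (y : nat -> int -> K^o) (c : nat -> nat).
Hypothesis y_supp : forall k j, y k j != 0 -> (`|j| <= c k)%N.
Hypothesis y_bound : forall k j, absv (y k j / phi K j) <= 2 ^+ c k.

Lemma exists_block_sum (m : nat -> nat) :
  (forall k l (n : int), (`|(n - (m k)%:Z)%R| <= c k)%N ->
     (`|(n - (m l)%:Z)%R| <= c l)%N -> k = l) ->
  exists u : int -> K^o,
    (forall k n, (`|(n - (m k)%:Z)%R| <= c k)%N ->
       u n = y k (n - (m k)%:Z) / phi K (n - (m k)%:Z)) /\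
    (forall n, (forall k, ~ (`|(n - (m k)%:Z)%R| <= c k)%N) -> u n = 0).
Proof.
move=> disj; pose block n k := (`|(n - (m k)%:Z)%R| <= c k)%N.
(* [cid] picks a block containing [n]; by disjointness it is the only one. *)
exists (fun n => if pselect (exists k, block n k) is left h then
  let k := projT1 (cid h) in y k (n - (m k)%:Z) / phi K (n - (m k)%:Z) else 0).
split=> [k n nk|n nn].
  case: pselect => [h|[]]; last by exists k.
  by case: (cid h) => l nl /=; rewrite (disj _ _ _ nk nl).
by case: pselect => // h; case: (h) => k nk; case: (nn k nk).
Qed.

(** One factor [2^-|n|] of the decay pays for [b], since [2^(s - |n|) <= 2^-l]; the other is
    kept. *)
Lemma absv_block_le (n : int) (b : K) (s l : nat) : expo n <= - `|n|%N%:Z ->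
  absv b <= 2 ^+ s -> (s + l <= `|n|)%N ->
  absv (phi K n * b) <= 2^-1 ^+ l * 2^-1 ^+ `|n|%N.
Proof.
move=> en bs sl; rewrite absvM.
apply: le_trans (ler_pM (absv_ge0 _) (absv_ge0 _) (absv_phi_le _ _ en) bs) _.
rewrite mulrAC ler_wpM2r ?exprn_ge0// -(subnK sl) addnA 2!exprD.
rewrite mulrAC -(mulrA _ _ (2 ^+ s)) -exprMn mulVf ?pnatr_eq0// expr1n mulr1.
rewrite -[leRHS]mul1r ler_wpM2r ?exprn_ge0// exprn_ile1// ?invr_ge0//.
by rewrite invf_le1// ler1n.
Qed.

Lemma exists_universal_vector : exists (u : int -> K^o) (m : nat -> nat),
  (forall n, absv (phi K n * u n) <= 2^-1 ^+ `|n|%N) /\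
  (forall l n, absv (phi K n * u (n + (m l)%:Z) - y l n) <=
     2^-1 ^+ l * 2^-1 ^+ `|n|%N).
Proof.
have [a [a1 a2]] := exists_fast_positions c.
pose m k := (2 * 8 ^ a k)%N.
have a3 k : (a k < 8 ^ a k)%N by exact: ltn_expl.
have disj_lt k l (n : int) : (k < l)%N -> (`|(n - (m k)%:Z)%R| <= c k)%N ->
    (`|(n - (m l)%:Z)%R| <= c l)%N -> False.
  by move=> kl; have := a2 _ _ kl; have := a1 l; have := a3 l; rewrite /m; lia.
have disj k l (n : int) : (`|(n - (m k)%:Z)%R| <= c k)%N ->
    (`|(n - (m l)%:Z)%R| <= c l)%N -> k = l.
  move=> nk nl; case: (ltngtP k l) => // kl; exfalso.
    exact: disj_lt kl nk nl.
  exact: disj_lt kl nl nk.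
have [u [uE u0]] := exists_block_sum m disj.
have expo_pos (n : int) : 0 <= n -> expo n <= - `|n|%N%:Z.
  by case: n => [i|i] //=; lia.
exists u, m; split=> [n|l n].
  have [[k nk]|/forallNP nn] := pselect (exists k, (`|(n - (m k)%:Z)%R| <= c k)%N).
    (* The case [l = 0] of [absv_block_le]. *)
    rewrite (uE k)// -[leRHS]mul1r -(expr0 2^-1).
    have h : (c k)%:Z <= n by have := a1 k; have := a3 k; move: nk; rewrite /m; lia.
    apply: absv_block_le (y_bound k _) _; [apply: expo_pos|]; lia.
  by rewrite u0// mulr0 absv0 exprn_ge0.
have rhs0 : 0 <= 2^-1 ^+ l * 2^-1 ^+ `|n|%N :> R by rewrite mulr_ge0 ?exprn_ge0.
have yl0 : ~ (`|n| <= c l)%N -> y l n = 0.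
  by move=> nl; apply/eqP; apply: contra_notT nl; exact: y_supp.
have nlE : (n + (m l)%:Z) - (m l)%:Z = n by rewrite addrK.
have [[k nk]|/forallNP nn] :=
    pselect (exists k, (`|(n + (m l)%:Z - (m k)%:Z)%R| <= c k)%N); last first.
  rewrite u0// mulr0 yl0 ?subr0 ?absv0//.
  by have := nn l; rewrite nlE.
(* Block [l] lands exactly on [y l]; in any other block [y l] vanishes, by disjointness. *)
rewrite (uE k)//; have [kl|kl] := eqVneq k l.
  by rewrite kl nlE mulrC divfK ?phi_neq0// subrr absv0.
rewrite yl0 ?subr0; last first.
  by rewrite -{1}nlE => nl; move/eqP: kl; apply; exact: disj nk nl.
have := a1 k; have := a1 l; have := a3 k; have := a3 l.
move: nk; rewrite /m; case: (ltngtP k l) kl => // kl _ nk h1 h2 h3 h4.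
  (* An earlier block: [-n] lies between [8 ^ a l] and [2 * 8 ^ a l]. *)
  have := a2 _ _ kl => h5.
  apply: absv_block_le (y_bound k _) _; last lia.
  have -> : n = - `|n|%N%:Z by lia.
  rewrite abszN absz_nat; apply: (@expo_le_neg (a l)); lia.
(* A later block is still at [n >= c k + l]. *)
have := a2 _ _ kl => h5.
apply: absv_block_le (y_bound k _) _; [apply: expo_pos|]; lia.
Qed.

End universal_vector.

(** * Countable density of finitely supported vectors *)

Definition dense_seq (R : realType) (K : absField R) (q : nat -> K) :=
  forall (a : K) (e : R), 0 < e -> exists i, absv (a - q i) < e.

(** Enumerates the rationals, respectively the Gaussian rationals. *)
Lemma exists_dense_seq (R : realType) (k : scalar_kind) :
  exists q : nat -> scalars R k, dense_seq R (scalars R k) q.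
Proof.
have approx (a e : R) : 0 < e -> exists r : rat, `|a - ratr r| < e.
  move=> e0; have /rat_in_itvoo[r] : a - e < a + e by lra.
  by rewrite in_itv/= => /andP[r1 r2]; exists r; rewrite ltr_norml; lra.
case: k => /=.
  exists (fun i => ratr (odflt 0 (unpickle i))) => a e e0.
  by have [r ar] := approx a e e0; exists (pickle r); rewrite pickleK.
exists (fun i => let r := odflt (0, 0) (unpickle i) in
  (ratr r.1 +i* ratr r.2)%C) => -[a b] e e0.
have [r ar] := approx a (e / 2) (divr_gt0 e0 (ltr0n _ 2)).
have [s bs] := approx b (e / 2) (divr_gt0 e0 (ltr0n _ 2)).
exists (pickle (r, s)); rewrite pickleK /=.
rewrite -(ger0_norm (ltW e0)) -sqrtr_sqr ltr_sqrt; last by rewrite exprn_gt0.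
rewrite -(real_normK (num_real (a - _))) -(real_normK (num_real (b - _))).
have := normr_ge0 (a - ratr r); have := normr_ge0 (b - ratr s).
by nra.
Qed.

Section finite_support.
Context {R : realType} (K : absField R).

(** Coding by lists of naturals makes this family of vectors countable; [pickle] numbers the
    coordinates. *)
Definition code_seq (q : nat -> K) (s : seq nat) : int -> K^o :=
  fun n => if (pickle n < size s)%N then q (nth 0%N s (pickle n)) else 0.

Lemma code_seq_bound (q : nat -> K) (s : seq nat) : exists c : nat,
  (forall j, code_seq q s j != 0 -> (`|j| <= c)%N) /\
  (forall j, absv (code_seq q s j / phi K j) <= 2 ^+ c).
Proof.
(* Adding both quantities lets one bound serve as radius and as size; the size then uses
   [c <= 2^c]. *)
pose F (i : nat) : R := if unpickle i is Some j
  then `|j|%N%:R + absv (code_seq q s j / phi K j) else 0.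
have F0 i : 0 <= F i.
  by rewrite /F; case: unpickle => // j; rewrite addr_ge0 ?absv_ge0.
pose c := Num.bound (\sum_(i < size s) F i).
have Fc j : (pickle j < size s)%N ->
    `|j|%N%:R + absv (code_seq q s j / phi K j) < c%:R.
  move=> js; apply: le_lt_trans (unstable.ltr_bound _).
  rewrite (bigD1 (Ordinal js))//= {1}/F pickleK.
  by rewrite lerDl sumr_ge0.
exists c; split=> j.
  rewrite /code_seq; case: ifPn => [/Fc h _|]; last by rewrite eqxx.
  rewrite -(ler_nat R); apply: ltW; apply: le_lt_trans h.
  by rewrite lerDl absv_ge0.
have [js|js] := boolP (pickle j < size s)%N.
  apply: (@le_trans _ _ c%:R).
    by apply: ltW; apply: le_lt_trans (Fc _ js); rewrite lerDr.
  by rewrite -natrX ler_nat ltnW// ltn_expl.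
by rewrite /code_seq (negbTE js) mul0r absv0 exprn_ge0.
Qed.

(** Some finite partial sum is within [t] of the total; cutting past the largest code of its indices
    leaves at most [t]. *)
Lemma lp_sum_tail (p t : R) (x : int -> K^o) : 0 < p ->
  x \in lp_pred p -> 0 < t -> exists s : nat,
    (lp_sum p (fun n => (if (pickle n < s)%N then 0 else x n)%R : K^o) <= t%:E)%E.
Proof.
move=> p0 xp t0; have fx := lp_sum_fin xp.
have [_ [X [finX _] <-] hX] := ub_ereal_sup_adherent t0 fx.
have [r Xr] : exists r : seq int, X = [set` r] by apply/finite_seqP.
exists (\max_(j <- r) pickle j).+1; set s := _.+1.
have Xs n : X n -> (pickle n < s)%N.
  by rewrite Xr /= ltnS => nr; exact: leq_bigmax_seq.
set tail := (X in lp_sum p X).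
pose head : int -> K^o := fun n => if (pickle n < s)%N then x n else 0.
have pos (z : int -> K^o) n : (0 <= (absv (z n) `^ p)%:E)%E.
  by rewrite lee_fin powR_ge0.
have splitE : (lp_sum p tail + lp_sum p head <= lp_sum p x)%E.
  rewrite /lp_sum -esumD//; apply: le_esum => n _.
  by rewrite /tail /head; case: ifP => _;
    rewrite absv0 powR0 ?gt_eqF// ?add0e ?adde0.
have headX : (lp_sum p x - t%:E <= lp_sum p head)%E.
  apply: le_trans (ltW hX) _; apply: esum_ge; exists X => //.
  rewrite le_eqVlt; apply/orP; left; apply/eqP; apply: eq_fsbigr => n.
  by rewrite inE => /Xs; rewrite /head => ->.
move: fx splitE headX; have := lp_sum_ge0 p tail; have := lp_sum_ge0 p head.
case: (lp_sum p x) => // a; case: (lp_sum p tail) => // [b|]; case: (lp_sum p head) => // d.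
rewrite -EFinD -EFinB !lee_fin => _ _ _; lra.
Qed.

(* The error is the tail of [x], where the code vanishes, plus a perturbation
   dominated by a geometric sequence. *)
Lemma code_seq_dense (p : R) (q : nat -> K) (x : int -> K^o) (e : R) :
  1 <= p -> dense_seq R K q -> x \in lp_pred p -> 0 < e -> exists s : seq nat,
    (fun n => x n - code_seq q s n) \in lp_pred p /\
    lp_norm p (fun n => x n - code_seq q s n) <= e.
Proof.
move=> p1 qd xp e0; have p0 : 0 < p := lt_le_trans ltr01 p1.
have [C C0 domC] := lp_norm_dominated R K p p1.
have e2 : 0 < e / 2 by rewrite divr_gt0.
have half_gt0 n : 0 < 2^-1 ^+ n :> R by rewrite exprn_gt0.
(* [C] may be 0, so [C + 1] is the divisor. *)
pose d := e / 2 / (C + 1); have d0 : 0 < d by rewrite !divr_gt0// ltr_wpDl.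
have dC : d * C <= e / 2.
  by rewrite /d mulrAC ler_pdivrMr ?ltr_wpDl// ler_wpM2l ?lerDl// divr_ge0 ?ltW.
have [idx idxP] := choice (fun n : int => qd (x n) (d * 2^-1 ^+ `|n|%N)
  (mulr_gt0 d0 (half_gt0 `|n|%N))).
have [s tail_s] := lp_sum_tail p ((e / 2) `^ p) x p0 xp (powR_gt0 _ e2).
have [z1p z1e] := lp_sum_le p0 (ltW e2) tail_s.
pose z2 : int -> K^o := fun n => if (pickle n < s)%N then x n - q (idx n) else 0.
have [] := domC z2 d (ltW d0).
  move=> n; rewrite /z2; case: ifP => _; first exact: ltW.
  by rewrite absv0 mulr_ge0 ?(ltW d0)// exprn_ge0.
move=> z2p z2e.
exists (mkseq (fun i => if unpickle i is Some n then idx n else 0%N) s).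
set z := (fun n => x n - _).
have -> : z = (fun n => (if (pickle n < s)%N then 0 else x n) + z2 n).
  apply/funext => n; rewrite /z /z2 /code_seq size_mkseq; case: ifPn => ns.
    by rewrite nth_mkseq// pickleK add0r.
  by rewrite addr0 subr0.
have [zp ze] := lp_minkowski p1 z1p z2p.
split; first exact: zp.
apply: (le_trans ze).
rewrite [leRHS]splitr.
exact: lerD z1e (le_trans z2e dC).
Qed.

End finite_support.

(** * Hypercyclicity and conclusion *)

(** Reading indices through [logn 2] makes every code recur infinitely often; the witness is [2^i]
    times the odd number [2 * L + 1]. *)
Lemma exists_large_logn (i L : nat) : exists2 l, (L <= l)%N & logn 2 l = i.
Proof.
exists (2 ^ i * L.*2.+1)%N.
  by rewrite (@leq_trans L.*2.+1)// ?leq_pmull ?expn_gt0//; lia.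
by rewrite lognM ?expn_gt0// pfactorK// lognE/= dvdn2/= odd_double addn0.
Qed.

Lemma shift_hypercyclic (R : realType) (K : absField R) (p : R) (p1 : 1 <= p)
    (q : nat -> K) : dense_seq R K q -> hypercyclic (bshift p1 (shift_weight K)).
Proof.
move=> qd; pose s l := odflt [::] (unpickle (logn 2 l)) : seq nat.
have [c cP] := choice (fun l => code_seq_bound K q (s l)).
have [u [m [xP uP]]] := exists_universal_vector K (fun l => code_seq K q (s l)) c
  (fun l => (cP l).1) (fun l => (cP l).2).
have [C C0 domC] := lp_norm_dominated R K p p1.
have [|xp _] := domC (fun n => phi K n * u n) 1 ler01.
  by move=> n; rewrite mul1r.
pose x : lp K p1 := Lp (p1 := p1) xp.
have iterE l n : iter (m l) (bshift p1 (shift_weight K)) x n =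
    phi K n * u (n + (m l)%:Z).
  by rewrite iter_shiftE /= mulrA divfK ?phi_neq0.
exists x => O [y Oy] openO.
have /nbhs_ballP[e /= e0 yO] : nbhs y O by move: openO; rewrite openE; exact.
have e2 : 0 < e / 2 by rewrite divr_gt0.
have [t [yt1 yt2]] := code_seq_dense K p q y (e / 2) p1 qd (lp_seqP y) e2.
(* [t] is fixed first; a late occurrence [l] of it then makes the error [2^-l * C] smaller than
   [e / 2]. *)
have [l Ll sl] := exists_large_logn (pickle t) (Num.bound (C / (e / 2))).
have st : s l = t by rewrite /s sl pickleK.
have lC : 2^-1 ^+ l * C < e / 2.
  rewrite exprVn mulrC ltr_pdivrMr ?exprn_gt0// -ltr_pdivrMl// mulrC.
  exact: upper_nthrootP.
exists (iter (m l) (bshift p1 (shift_weight K)) x); split; last by exists (m l).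
apply: yO; rewrite -ball_normE /=.
have [] := domC (fun n => code_seq K q t n - phi K n * u (n + (m l)%:Z))
  (2^-1 ^+ l).
- by rewrite exprn_ge0.
- by move=> n; rewrite -absvN opprB -st.
move=> wp wC; have [_] := lp_minkowski p1 yt1 wp.
rewrite lp_normE; set v := (X in lp_norm p X <= _); set v' := (X in lp_norm p X < _).
have <- : v = v'.
  by apply/funext => n; rewrite /v addrA subrK -iterE.
move=> vle; apply: (le_lt_trans vle); rewrite [ltRHS]splitr.
exact: ler_ltD yt2 (le_lt_trans wC lC).
Qed.

Theorem proposition3p9 (R : realType) (k : scalar_kind) (p : R) (p1 : 1 <= p) :
  exists w : weight (scalars R k),
    hypercyclic (bshift p1 w) /\
    forall x : lp (scalars R k) p1, x != 0 ->
      (n%:R^-1 * \sum_(1 <= i < n.+1) `|iter i (bshift p1 w) x|)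
        @[n --> \oo] --> (+oo : set_system R).
Proof.
have [q qd] := exists_dense_seq R k.
exists (shift_weight _); split; first exact: shift_hypercyclic qd.
exact: shift_cesaro.
Qed.
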